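(* Let $w$ be a weight on $\mathbb N_0$ satisfying the discrete Pearson equation $$\theta(k+1)\,w(k+1)=\sigma(k)\,w(k),\qquad k\in\mathbb N_0,$$ where $\theta,\sigma$ are polynomials with $\theta(0)=0$. Then the moment matrix $G$ of $w$ fulfills $$\theta(\Lambda)\,G=B\,\sigma(\Lambda)\,G\,B^\top .$$
   Context: $\mathbb N_0=\{0,1,2,\dots\}$; all matrices are semi-infinite with rows and columns indexed by $\mathbb N_0$. The weight $w$ takes finite values $w(k)$, $k\in\mathbb N_0$, and defines the linear functional $\rho=\sum_{k=0}^\infty\delta(z-k)w(k)$; its moments $\rho_n=\sum_{k=0}^\infty k^n w(k)$ are assumed to be (absolutely) convergent for all $n\in\mathbb N_0$ (with $0^0=1$). The moment (Gram) matrix is $G=(\rho_{n+m})_{n,m\in\mathbb N_0}=\sum_{k=0}^\infty\chi(k)\chi(k)^\top w(k)$, with $\chi(z)=(1,z,z^2,\dots)^\top$. $\Lambda$ is the shift matrix with ones on the first superdiagonal and zeros elsewhere (so $\Lambda\chi(z)=z\chi(z)$), and for a polynomial $R(z)=\sum_j r_jz^j$ one sets $R(\Lambda)=\sum_j r_j\Lambda^j$. $B$ is the lower Pascal matrix: $B_{n,m}=\binom nm$ if $n\ge m$ and $B_{n,m}=0$ if $n<m$ (so $\chi(z+1)=B\chi(z)$). *)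

(* Defs.v *)
From HB Require Import structures.
From mathcomp Require Import all_boot all_order all_algebra.
From mathcomp Require Import all_classical all_reals all_analysis.

Set Implicit Arguments.
Unset Strict Implicit.
Unset Printing Implicit Defensive.

Import Order.TTheory GRing.Theory Num.Theory.
Import numFieldNormedType.Exports.

Local Open Scope classical_set_scope.
Local Open Scope ring_scope.

(* The scalar field K is any numFieldType, with the topology
   given by its norm; this covers both the reals (K := R) and the complex
   numbers (K := R[i]), for R : realType. *)

(* Semi-infinite matrices, rows and columns indexed by nat. *)
Definition smatrix (K : Type) := nat -> nat -> K.

Section SemiInfinite.
Variable K : numFieldType.
Implicit Types (A B : smatrix K) (p : {poly K}) (w : nat -> K).

(* The (n, m) entry is the sum of the series of A n k * B k m over all k in nat.
   This sum is finite as soon as the rows of A or the columns of B have finite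
   support. *)
Definition smul A B : smatrix K :=
  fun n m => limn (series (fun k : nat => A n k * B k m)).

Definition strmx A : smatrix K := fun n m => A m n.

Definition sid : smatrix K := fun n m => (n == m)%:R.

Definition spow A (j : nat) : smatrix K := iter j (smul A) sid.

Definition spoly p A : smatrix K :=
  fun n m => \sum_(j < size p) p`_j * spow A j n m.

Definition sshift : smatrix K := fun n m => (m == n.+1)%:R.

(* 'C(n, m) = 0 for n < m, so this matrix is lower triangular. *)
Definition spascal : smatrix K := fun n m => 'C(n, m)%:R.

Definition moment_term w (n k : nat) : K := k%:R ^+ n * w k.

(* Absolute convergence includes convergence: when K is complete (in particular
   for the reals and the complex numbers) the first conjunct follows from the
   second one, but a general numFieldType need not be complete. *)
Definition absolutely_convergent (u : nat -> K) : Prop :=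
  cvgn (series u) /\ cvgn (series (fun k => `|u k|)).

Definition has_moments w : Prop :=
  forall n, absolutely_convergent (moment_term w n).

Definition moment w (n : nat) : K := limn (series (moment_term w n)).

Definition gram w : smatrix K := fun n m => moment w (n + m).

Definition pearson (theta sigma : {poly K}) w : Prop :=
  forall k : nat, theta.[k.+1%:R] * w k.+1 = sigma.[k%:R] * w k.

End SemiInfinite.

Arguments sid {K}.
Arguments sshift {K}.
Arguments spascal {K}.

Declare Scope smatrix_scope.
Delimit Scope smatrix_scope with SM.
Infix "*s" := smul (at level 40, left associativity) : smatrix_scope.

(* Main.v *)
Require Import Defs.
From mathcomp Require Import all_boot all_order all_algebra.
From mathcomp Require Import all_classical all_reals all_analysis.

Import Order.TTheory GRing.Theory Num.Theory.
Import numFieldNormedType.Exports.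

Local Open Scope ring_scope.
Local Open Scope smatrix_scope.

(** Row [n] of [theta(Lambda)] lists the coefficients of [X^n theta], and row
    [n] of [B sigma(Lambda)] those of [(X + 1)^n sigma].  Writing [rho] for the
    functional [q |-> sum_k q(k) w(k)], the entries of the two sides are
    therefore [rho(X^n theta X^m)] and [rho((X + 1)^n sigma (X + 1)^m)].  The
    term [k = 0] of the first sum vanishes because [theta(0) = 0], and the
    Pearson equation turns the term [k + 1] of the first sum into the term [k]
    of the second. *)

Section FiniteSums.
Context {K : numFieldType}.
Implicit Types (a p : {poly K}) (A C : smatrix K).

(** Coefficients vanish from index [size a] on, so the partial sums are eventually constant. No
    convergence assumption on [f] is involved. *)
Lemma limn_series_coef a (f : nat -> K) :
  limn (series (fun k => a`_k * f k)) = \sum_(k < size a) a`_k * f k.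
Proof.
apply: cvg_lim; first exact: norm_hausdorff.
apply: cvg_near_cst; near=> n.
rewrite /series /= (@big_cat_nat _ _ _ (size a)) //=; last first.
  by near: n; exact: nbhs_infty_ge.
rewrite big_mkord [X in _ + X]big_nat_cond [X in _ + X]big1 ?addr0 // => i.
by case/andP=> /andP[le_ai _] _; rewrite nth_default ?mul0r.
Unshelve. all: by end_near. Qed.

Lemma smul_row {a A C} n m : (forall k, A n k = a`_k) ->
  (A *s C) n m = \sum_(k < size a) a`_k * C k m.
Proof.
move=> rowA; rewrite /smul -(limn_series_coef a (C ^~ m)).
by congr (limn (series _)); apply: funext => k; rewrite rowA.
Qed.

Lemma spow_sshiftE j n m : spow (@sshift K) j n m = (m == n + j)%N%:R.
Proof.
elim: j n => [|j IHj] n; first by rewrite addn0 eq_sym.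
(* Row [n] of the shift is ['X^(n.+1)], so only the last term of the finite sum survives: row [n.+1]
   of the previous power. *)
rewrite /spow iterS (@smul_row 'X^(n.+1)); last by move=> k; rewrite coefXn.
rewrite size_polyXn big_ord_recr /= big1 => [|i _].
  by rewrite coefXn eqxx mul1r add0r -/(spow _ _) IHj addnS addSn.
by rewrite coefXn ltn_eqF ?mul0r.
Qed.

Lemma spoly_sshiftE p n m : spoly p sshift n m = ('X^n * p)`_m.
Proof.
rewrite -[in RHS](coefK p) poly_def mulr_sumr coef_sum /spoly.
apply: eq_bigr => j _.
by rewrite spow_sshiftE -scalerAr -exprD coefZ coefXn.
Qed.

Lemma spascalE n m : @spascal K n m = (('X + 1) ^+ n)`_m.
Proof.
(* With ['X] as the second summand, the binomial index is the exponent of ['X]. *)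
rewrite addrC exprDn coef_sum /spascal.
under eq_bigr do rewrite expr1n mul1r coefMn coefXn.
have [le_mn|lt_nm] := leqP m n; last first.
  rewrite bin_small // big1 // => i _.
  by rewrite gtn_eqF ?mul0rn // (leq_trans (ltn_ord i)).
rewrite (bigD1 (Ordinal (le_mn : (m < n.+1)%N))) //= eqxx big1 ?addr0 // => i.
by rewrite -val_eqE /= eq_sym => /negPf ->; rewrite mul0rn.
Qed.

Lemma spascal_spoly_sshiftE p n m :
  (spascal *s spoly p sshift) n m = (('X + 1) ^+ n * p)`_m.
Proof.
rewrite (smul_row _ _ (spascalE n)).
rewrite -[in RHS](coefK (('X + 1) ^+ n)) poly_def mulr_suml coef_sum.
by apply: eq_bigr => k _; rewrite spoly_sshiftE -scalerAl coefZ.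
Qed.

End FiniteSums.

Section MomentFunctional.
Local Open Scope classical_set_scope.
Local Open Scope ring_scope.
Context {K : numFieldType} (w : nat -> K).
Hypothesis hw : has_moments w.
Implicit Types p q : {poly K}.

Definition weighted q (k : nat) : K := q.[k%:R] * w k.

Definition moment_functional q : K := limn (series (weighted q)).

Local Notation rho := moment_functional.

(** Linearity holds already for partial sums; limits enter only afterwards. *)
Lemma series_weighted_sum (N : nat) (c : nat -> K) (q : nat -> {poly K}) :
  series (weighted (\sum_(i < N) c i *: q i)) =
  (fun n => \sum_(i < N) c i * series (weighted (q i)) n).
Proof.
apply: funext => n; rewrite /series /=.
under [RHS]eq_bigr do rewrite mulr_sumr.
rewrite exchange_big; apply: eq_bigr => k _ /=.
rewrite /weighted horner_sum mulr_suml; apply: eq_bigr => i _.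
by rewrite hornerZ mulrA.
Qed.

Lemma cvgn_sum_scale {N : nat} (c : nat -> K) {u : nat -> nat -> K} :
  (forall i, cvgn (u i)) ->
  (fun n => \sum_(i < N) c i * u i n) @ \oo --> \sum_(i < N) c i * limn (u i).
Proof.
move=> cvu; elim: N => [|N IHN].
  under eq_fun do rewrite big_ord0.
  by rewrite big_ord0; exact: cvg_cst.
under eq_fun do rewrite big_ord_recr /=.
by rewrite big_ord_recr /=; apply: cvgD => //; apply: cvgMr; exact: cvu.
Qed.

Lemma moment_termE n : moment_term w n = weighted 'X^n.
Proof. by apply: funext => k; rewrite /weighted hornerXn. Qed.

Lemma momentE n : moment w n = rho 'X^n.
Proof. by rewrite /moment moment_termE. Qed.

Lemma is_cvg_series_weighted q : cvgn (series (weighted q)).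
Proof.
have cvX i : cvgn (series (weighted 'X^i)).
  by rewrite -moment_termE; case: (hw i).
rewrite -(coefK q) poly_def.
rewrite (series_weighted_sum _ (fun i => q`_i) (fun i => 'X^i)).
exact: cvgP (cvgn_sum_scale (fun i => q`_i) cvX).
Qed.

Lemma moment_functional_sum (N : nat) (c : nat -> K) (q : nat -> {poly K}) :
  \sum_(i < N) c i * rho (q i) = rho (\sum_(i < N) c i *: q i).
Proof.
apply/esym/cvg_lim; first exact: norm_hausdorff.
rewrite series_weighted_sum.
exact: (cvgn_sum_scale c (fun i => is_cvg_series_weighted (q i))).
Qed.

Lemma smul_gramE {a : {poly K}} {A : smatrix K} n m :
  (forall k, A n k = a`_k) -> (A *s gram w) n m = rho (a * 'X^m).
Proof.
move=> rowA; rewrite (smul_row _ _ rowA).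
under eq_bigr do rewrite /gram momentE.
rewrite (moment_functional_sum _ (fun k => a`_k) (fun k => 'X^(k + m))).
rewrite -[in RHS](coefK a) poly_def mulr_suml; congr (rho _).
by apply: eq_bigr => k _; rewrite exprD scalerAl.
Qed.

(** The row of [A] may have infinite support here. The product is a finite sum because column [m] of
    the transposed Pascal matrix lists the coefficients of [('X + 1) ^+ m]. *)
Lemma smul_strmx_spascalE {a : {poly K}} {A : smatrix K} n m :
  (forall k, A n k = rho (a * 'X^k)) ->
  (A *s strmx spascal) n m = rho (a * ('X + 1) ^+ m).
Proof.
move=> rowA; rewrite /smul.
under eq_fun do rewrite rowA /strmx spascalE mulrC.
rewrite limn_series_coef.
rewrite (moment_functional_sum _ (fun k => (('X + 1) ^+ m)`_k)
  (fun k => a * 'X^k)).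
rewrite -[in RHS](coefK (('X + 1) ^+ m)) poly_def mulr_sumr; congr (rho _).
by apply: eq_bigr => k _; rewrite scalerAr.
Qed.

Lemma moment_functional_shift p q :
  p.[0] = 0 -> (forall k, weighted p k.+1 = weighted q k) -> rho p = rho q.
Proof.
move=> p0 pq; apply: cvg_lim; first exact: norm_hausdorff.
(* Dropping the zero term makes partial sum [n.+1] for [p] equal to partial sum [n] for [q]. *)
rewrite -cvg_shiftS /=.
suff -> : (fun n => series (weighted p) n.+1) = series (weighted q).
  exact: is_cvg_series_weighted.
apply: funext => n; rewrite /series /= big_nat_recl // {1}/weighted p0 mul0r.
by rewrite add0r; apply: eq_bigr => k _; rewrite pq.
Qed.

End MomentFunctional.

Theorem theorem1 (K : numFieldType) (w : nat -> K) (theta sigma : {poly K})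
    (hw : has_moments w) (htheta : theta.[0] = 0)
    (hP : pearson theta sigma w) :
  spoly theta sshift *s gram w
    = spascal *s spoly sigma sshift *s gram w *s strmx spascal.
Proof.
apply: funext => n; apply: funext => m.
rewrite (smul_gramE w hw _ _ (spoly_sshiftE theta n)).
rewrite (smul_strmx_spascalE w hw n m
  (fun k => smul_gramE w hw n k (spascal_spoly_sshiftE sigma n))).
apply: moment_functional_shift => // [|k].
  by rewrite !hornerM htheta mulr0 mul0r.
(* The value of ['X + 1] at [k] is that of ['X] at [k.+1], so the outer powers agree and the Pearson
   equation settles the rest. *)
rewrite /weighted !hornerM !horner_exp hornerD !hornerX hornerC natr1.
by rewrite [_ * theta.[_] * _]mulrAC [_ * sigma.[_] * _]mulrAC -!mulrA hP.
Qed.
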